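(* Let $(k,q)$ be a semiprimitive pair with $q=p^m$, $m$ even, and put $n=\frac{q-1}{k}$. Let $\sigma$ be as defined in the context. Then $$\mathrm{Spec}(\Gamma(k,q))=\{[n]^1,[\lambda_1]^n,[\lambda_2]^{(k-1)n}\},\qquad \mathrm{Spec}(\bar\Gamma(k,q))=\{[(k-1)n]^1,[(k-1)\lambda_2]^n,[-1-\lambda_2]^{(k-1)n}\},$$ where $$\lambda_1=\frac{\sigma(k-1)p^{m/2}-1}{k},\qquad \lambda_2=-\frac{\sigma p^{m/2}+1}{k},$$ and the three values $n,\lambda_1,\lambda_2$ are pairwise distinct.
   Context: Let $p$ be prime, $q=p^m$, $k\mid q-1$, $R_k=\{x^k:x\in\mathbb F_q^*\}$. The generalized Paley graph $\Gamma(k,q)$ is the Cayley graph with vertex set $\mathbb F_q$ where $u\to v$ is an edge iff $v-u\in R_k$; $\bar\Gamma(k,q)$ is the Cayley graph on $\mathbb F_q$ with connection set $\mathbb F_q^*\setminus R_k$. Spectrum = multiset of adjacency eigenvalues, written $\{[\lambda]^{\text{mult}}\}$. A pair $(k,q)$ with $q=p^m$ and $k\mid q-1$ is called a semiprimitive pair if either $k=2$ and $q\equiv1\pmod 4$, or $k>2$, $k\mid p^t+1$ for some $t\mid\frac m2$, and $k\neq p^{m/2}+1$. For a semiprimitive pair with $m$ even, let $t$ be the least positive integer $j$ with $k\mid p^j+1$, put $s=\frac{m}{2t}$, and $\sigma=(-1)^{s+1}$. *)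

(* Defs.v *)
From HB Require Import structures.
From mathcomp Require Import all_boot all_order all_algebra all_field.
Set Implicit Arguments. Unset Strict Implicit. Unset Printing Implicit Defensive.
Import Order.TTheory GRing.Theory Num.Theory.
Local Open Scope ring_scope.

Definition kth_powers (F : finFieldType) (k : nat) : {set F} :=
  [set x ^+ k | x in [set y : F | y != 0]].

Definition cayley_adj (F : finFieldType) (S : {set F}) : 'M[algC]_#|F| :=
  \matrix_(i, j) (if (enum_val j - enum_val i) \in S then 1 else 0).

Definition paley_adj (F : finFieldType) (k : nat) : 'M[algC]_#|F| :=
  cayley_adj (kth_powers F k).

Definition paley_bar_adj (F : finFieldType) (k : nat) : 'M[algC]_#|F| :=
  cayley_adj ([set x : F | x != 0] :\: kth_powers F k).

Definition semiprimitive (p m k : nat) : Prop :=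
  ((k %| p ^ m - 1) /\
   ((k = 2 /\ p ^ m %% 4 = 1) \/
    (2 < k /\ (exists t : nat, 0 < t /\ t %| m./2 /\ k %| p ^ t + 1)
     /\ k <> p ^ (m./2) + 1)))%N.

(* Main.v *)
Require Import Defs.
From HB Require Import structures.
From mathcomp Require Import all_boot all_order all_algebra all_field.
From mathcomp Require Import all_solvable ring zify.
Import Order.TTheory GRing.Theory Num.Theory.
Local Open Scope ring_scope.

(* The additive characters diagonalize every Cayley matrix of F, so the spectrum
   of Gamma(k, q) consists of the Gaussian periods, the sums of psi (b y) over
   y in R_k.  Put Q = p ^ t and K = Q + 1, so that q = Q ^ (2 s) and k | K | q - 1.
   For b != 0, let G(b) be the sum of psi (b x ^ K) over x in F.  As x ^ K is a
   Hermitian form, G(b) ^ 2 = q unless the form b x ^ K is degenerate, which can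
   only happen when b lies in the coset z R_K with z ^ (Q - 1) = -1; integrality
   modulo K determines the sign of G(b).  On z R_K the sum G is constant, and its
   value there follows from the fact that the sum of G(b) over all b is q.
   Averaging over R_k passes from the periods of R_K to those of R_k. *)

(** * Powers and primitive roots in a finite field *)

Section KthPowers.
Variable F : finFieldType.
Implicit Types (x y : F) (k : nat).

Lemma card_predn_gt0 : (0 < #|F|.-1)%N.
Proof. by rewrite -subn1 subn_gt0 finNzRing_gt1. Qed.

Lemma expf_card_pred x : x != 0 -> x ^+ #|F|.-1 = 1.
Proof.
move=> x0; apply: (mulfI x0); rewrite -exprS prednK ?expf_card ?mulr1 //.
by apply/card_gt0P; exists 0.
Qed.

Lemma finField_prim_root : exists g : F, #|F|.-1.-primitive_root g.
Proof.
suff /hasP[g _ gP] : has #|F|.-1.-primitive_root (enum (predC1 (0 : F))) by exists g.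
apply: has_prim_root (enum_uniq _) _; first exact: card_predn_gt0.
  apply/allP => x; rewrite mem_enum inE => x0.
  by apply/unity_rootP; rewrite expf_card_pred.
by rewrite -cardE cardC1.
Qed.

Lemma prim_root_expr (g x : F) : #|F|.-1.-primitive_root g -> x != 0 ->
  exists i, x = g ^+ i.
Proof.
move=> gP x0; have [i ->] := prim_rootP gP (expf_card_pred x x0).
by exists i.
Qed.

Lemma card_unity_roots k : (k %| #|F|.-1)%N -> #|[set x : F | x ^+ k == 1]| = k.
Proof.
have [g gP] := finField_prim_root => kq.
have hP := dvdn_prim_root gP kq; set h := g ^+ _ in hP.
have h_inj : injective (fun i : 'I_k => h ^+ i).
  move=> i j /eqP; rewrite (eq_prim_root_expr hP) !modn_small //.
  by move/eqP/val_inj.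
rewrite -[RHS]card_ord -(card_imset _ h_inj).
apply: eq_card => x; rewrite inE; apply/eqP/imsetP => [xk|[i _ ->]].
  by have [i ->] := prim_rootP hP xk; exists i.
by rewrite exprAC (prim_expr_order hP) expr1n.
Qed.

Lemma kth_powersP k y :
  reflect (exists2 x, x != 0 & y = x ^+ k) (y \in kth_powers F k).
Proof.
apply: (iffP imsetP) => [[x]|[x x0 ->]]; first by rewrite inE; exists x.
by exists x; rewrite ?inE.
Qed.

Lemma kth_powers_neq0 k y : y \in kth_powers F k -> y != 0.
Proof. by case/kth_powersP => x x0 ->; rewrite expf_neq0. Qed.

Lemma kth_powersM k : {in kth_powers F k &, forall y z, y * z \in kth_powers F k}.
Proof.
move=> _ _ /kth_powersP[x x0 ->] /kth_powersP[z z0 ->].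
by apply/kth_powersP; exists (x * z); rewrite ?mulf_neq0 ?exprMn.
Qed.

Lemma kth_powersV k y : y \in kth_powers F k -> y^-1 \in kth_powers F k.
Proof.
case/kth_powersP=> x x0 ->; apply/kth_powersP.
by exists x^-1; rewrite ?invr_neq0 ?exprVn.
Qed.

Lemma kth_powersMr k y z : z \in kth_powers F k ->
  (y * z \in kth_powers F k) = (y \in kth_powers F k).
Proof.
move=> zk; apply/idP/idP => [yzk|yk]; last exact: kth_powersM.
by rewrite -[y](mulfK (kth_powers_neq0 _ _ zk)) kth_powersM ?kth_powersV.
Qed.

Lemma kth_powersS k l : (k %| l)%N -> kth_powers F l \subset kth_powers F k.
Proof.
case/dvdnP=> a ->; apply/subsetP => _ /kth_powersP[x x0 ->].
by apply/kth_powersP; exists (x ^+ a); rewrite ?expf_neq0 // exprM.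
Qed.

(** The fibre of the [k]-th power map over [z ^+ k] is [z] times the group of [k]-th roots of unity,
    so every fibre has [k] elements. *)
Lemma sum_expr_kth_powers (V : nmodType) k (f : F -> V) : (k %| #|F|.-1)%N ->
  \sum_(x : F | x != 0) f (x ^+ k) = (\sum_(y in kth_powers F k) f y) *+ k.
Proof.
move=> kq; rewrite (partition_big (fun x => x ^+ k) (mem (kth_powers F k))) /=.
  rewrite -sumrMnl; apply: eq_bigr => y /kth_powersP[z z0 ->].
  rewrite (eq_bigr (fun=> f (z ^+ k))) => [|x /andP[_ /eqP->]] //.
  rewrite sumr_const; congr (_ *+ _); rewrite -[RHS](card_unity_roots k kq).
  rewrite -[RHS](card_imset _ (mulIf z0)). apply: eq_card => x.
  apply/idP/imsetP => [/andP[x0 /eqP xz]|[w]].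
    exists (x / z); last by rewrite divfK.
    by rewrite inE expr_div_n xz divff ?expf_neq0.
  rewrite inE => /eqP wk ->; rewrite unfold_in /= exprMn wk mul1r eqxx andbT.
  rewrite mulf_neq0 //; apply/eqP => w0; have k0: (0 < k)%N.
    exact: dvdn_gt0 card_predn_gt0 kq.
  by move/eqP: wk; rewrite w0 expr0n eqn0Ngt k0 /= eq_sym oner_eq0.
by move=> x x0; apply/kth_powersP; exists x.
Qed.

Lemma card_kth_powers k : (k %| #|F|.-1)%N -> (#|kth_powers F k| * k)%N = #|F|.-1.
Proof.
move=> kq; have := sum_expr_kth_powers _ k (fun=> 1%N) kq.
rewrite !sum1_card -mulr_natr natn => /esym; rewrite -(cardC1 (0 : F)); exact.
Qed.

End KthPowers.

(** * The trace character *)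

Lemma exprD_pchar_pow (R : comNzRingType) p e (x y : R) : p \in [pchar R] ->
  (x + y) ^+ (p ^ e) = x ^+ (p ^ e) + y ^+ (p ^ e).
Proof.
move=> chp; apply: exprDn_pchar.
by rewrite pnatX (eq_pnat _ (pcharf_eq chp)) pnat_id ?(pcharf_prime chp).
Qed.

Section Trace.
Variables (F : finFieldType) (p m : nat).
Hypotheses (hp : prime p) (hq : #|F| = (p ^ m)%N).

Let chp : p \in [pchar F]. Proof. exact: card_finPcharP hq hp. Qed.

(** The absolute trace onto the prime field, kept with values in [F]. *)
Definition prime_trace (x : F) : F := \sum_(i < m) x ^+ (p ^ i).

Lemma prime_traceD x y : prime_trace (x + y) = prime_trace x + prime_trace y.
Proof.
by rewrite -big_split; apply: eq_bigr => i _; exact: exprD_pchar_pow.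
Qed.

Lemma prime_trace0 : prime_trace 0 = 0.
Proof. by apply: (addrI (prime_trace 0)); rewrite -prime_traceD !addr0. Qed.

Lemma card_field_exp_gt0 : (0 < m)%N.
Proof. by have := finNzRing_gt1 F; rewrite hq; case: m. Qed.

(** The Frobenius map shifts the summands cyclically, because [x ^+ (p ^ m) = x]. *)
Lemma prime_traceX x : prime_trace (x ^+ p) = prime_trace x.
Proof.
rewrite /prime_trace; have: x ^+ (p ^ m) = x by rewrite -hq expf_card.
case: m card_field_exp_gt0 => // n _ xq.
rewrite big_ord_recr [RHS]big_ord_recl /= -exprM -expnS xq expr1 addrC.
by congr (_ + _); apply: eq_bigr => i _; rewrite -exprM -expnS.
Qed.

Lemma expr_prime_trace x : prime_trace x ^+ p = prime_trace x.
Proof.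
rewrite -[RHS]prime_traceX -(pFrobenius_autE chp) rmorph_sum.
by apply: eq_bigr => i _; rewrite /= pFrobenius_autE exprAC.
Qed.

(** The trace is a nonzero polynomial of degree below [p ^ m], so it cannot vanish on all of [F]. *)
Lemma prime_trace_neq0 : exists x, prime_trace x != 0.
Proof.
apply/existsP; apply: contraT; rewrite negb_exists => /forallP tr0.
pose P : {poly F} := \sum_(i < m) 'X^(p ^ i).
have PE x : P.[x] = prime_trace x.
  by rewrite horner_sum; apply: eq_bigr => i _; rewrite hornerXn.
have P0 : P != 0.
  apply/eqP => /(congr1 (fun P : {poly F} => P`_1)); rewrite coef0 coef_sum.
  case: m card_field_exp_gt0 => // n _; rewrite big_ord_recl coefXn /= big1 => [|i _].
    by move/eqP; rewrite addr0 oner_eq0.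
  by rewrite coefXn (ltn_eqF (ltn_expl _ _)) // -{1}(expn0 p) ltn_exp2l ?prime_gt1.
have sP : (size P <= p ^ m)%N.
  apply: leq_trans (size_sum _ _ _) _; apply/bigmax_leqP => i _.
  by rewrite size_polyXn ltn_exp2l ?prime_gt1.
have := @max_poly_roots F P (enum F) P0.
rewrite enum_uniq -cardE hq ltnNge sP; apply=> //.
by apply/allP => x _; apply/rootP; rewrite PE; apply/eqP; have := tr0 x; rewrite negbK.
Qed.

(** The images of [0, ..., p - 1] are already [p] roots of ['X^p - 'X]; one more root would exceed
    its degree. *)
Lemma natr_of_expr_fix (y : F) : y ^+ p = y -> exists n, y = n%:R.
Proof.
move=> yp; have p1 := prime_gt1 hp.
pose s := [seq (n%:R : F) | n <- iota 0 p].
have [/mapP[n _ ->]|ys] := boolP (y \in s); first by exists n.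
have sX : size ('X^p - 'X : {poly F}) = p.+1.
  by rewrite size_polyDl size_polyXn // size_polyN size_polyX.
have: ('X^p - 'X : {poly F}) != 0 by rewrite -size_poly_eq0 sX.
move/(@max_poly_roots F _ (y :: s)); rewrite sX /= size_map size_iota ltnn => W.
suff: false by [].
apply: W; last first.
  rewrite ys map_inj_in_uniq ?iota_uniq // => i j.
  wlog ij : i j / (i <= j)%N.
    by move=> W ip jp e; case/orP: (leq_total i j) => h; [|symmetry]; apply: W.
  rewrite !mem_iota /= add0n => ip jp e; apply/eqP; rewrite eqn_leq ij /=.
  have: (j - i)%:R == 0 :> F by rewrite natrB // e subrr.
  rewrite -(dvdn_pcharf chp) /dvdn modn_small ?subn_eq0 //.
  by rewrite (leq_ltn_trans (leq_subr _ _)).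
rewrite rootE !hornerE yp subrr eqxx /=.
apply/allP => _ /mapP[n _ ->]; rewrite rootE !hornerE.
by rewrite -(pFrobenius_autE chp) pFrobenius_aut_nat subrr.
Qed.

End Trace.

(** These are the only properties of [psi] used later: nontriviality gives orthogonality, Frobenius
    invariance linearizes the Hermitian form, and integrality fixes signs. *)
Record trace_character (F : finFieldType) (p : nat) (psi : F -> algC) : Prop :=
  TraceCharacter {
    trchar0 : psi 0 = 1;
    trcharD : forall x y, psi (x + y) = psi x * psi y;
    trcharX : forall x, psi (x ^+ p) = psi x;
    trchar_neq1 : exists x, psi x != 1;
    trchar_Aint : forall x, psi x \in Aint
  }.

(** The character is [z ^+ Tr x] for a primitive [p]-th root of unity [z]. *)
Lemma trace_character_exists (F : finFieldType) (p m : nat) :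
  prime p -> #|F| = (p ^ m)%N -> exists psi, @trace_character F p psi.
Proof.
move=> hp hq; have chp := card_finPcharP hq hp.
have [z zP] := C_prim_root_exists (prime_gt0 hp).
(* [lg] lifts an element of the prime field to its representative below [p]; elsewhere it takes the
   default value [p], which never occurs on traces. *)
pose s := [seq (n%:R : F) | n <- iota 0 p]; pose lg (y : F) := index y s.
have lg_nat n : z ^+ lg n%:R = z ^+ n.
  have ns : n%:R \in s.
    apply/mapP; exists (n %% p)%N; first by rewrite mem_iota ltn_pmod ?prime_gt0.
    by rewrite {1}(divn_eq n p) natrD natrM (pcharf0 chp) mulr0 add0r.
  have := nth_index 0 ns; rewrite (nth_map 0) ?size_iota; last first.
    by move: ns; rewrite -index_mem size_map size_iota.
  rewrite nth_iota ?add0n -/(lg n%:R); last first.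
    by move: ns; rewrite -index_mem size_map size_iota.
  move: (lg _) => l e; apply/eqP; rewrite (eq_prim_root_expr zP).
  wlog ln : l n e {ns} / (l <= n)%N.
    move=> W; case/orP: (leq_total l n) => h; first exact: W.
    by rewrite eq_sym W.
  by rewrite eq_sym eqn_mod_dvd // (dvdn_pcharf chp) natrB // e subrr.
pose tr := @prime_trace F p m.
have trP x : exists n, tr x = n%:R.
  by apply: (natr_of_expr_fix F p m) => //; exact: expr_prime_trace.
exists (fun x => z ^+ lg (tr x)); split.
- by rewrite /tr prime_trace0 // -[0]/(0%:R) lg_nat.
- move=> x y; rewrite /tr prime_traceD // -!/(tr _).
  have [a ->] := trP x; have [b ->] := trP y.
  by rewrite -natrD !lg_nat exprD.
- by move=> x; rewrite /tr prime_traceX.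
- have [x x0] := prime_trace_neq0 F p m hp hq; exists x.
  move: x0; rewrite -/(tr x); have [a ->] := trP x.
  by rewrite lg_nat -(prim_order_dvd zP) (dvdn_pcharf chp).
- by move=> x; rewrite rpredX ?(Aint_prim_root zP).
Qed.

(** * Gaussian periods and Cayley spectra *)

Section Characters.
Variables (F : finFieldType) (p : nat) (psi : F -> algC).
Hypothesis psiP : trace_character F p psi.

Let psi0 := trchar0 _ _ _ psiP.
Let psiD := trcharD _ _ _ psiP.

Lemma trcharXn e x : psi (x ^+ (p ^ e)) = psi x.
Proof.
elim: e x => [|e IH] x; first by rewrite expn0 expr1.
by rewrite expnS exprM IH (trcharX _ _ _ psiP).
Qed.

Lemma sum_trchar c : \sum_x psi (c * x) = (#|F| * (c == 0))%:R.
Proof.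
have [->|c0] := eqVneq c 0.
  rewrite muln1 (eq_bigr (fun=> 1)) => [|x _]; last by rewrite mul0r psi0.
  by rewrite sumr_const.
rewrite muln0; have [w w1] := trchar_neq1 _ _ _ psiP.
(* Translating the summation variable by [w / c] multiplies the sum by [psi w], which differs from
   1. *)
apply: (mulfI (x := psi w - 1)); first by rewrite subr_eq0.
rewrite mulr0 mulrBl mul1r mulr_sumr [X in _ - X](reindex_inj (addIr (w / c))) /=.
apply/eqP; rewrite subr_eq0; apply/eqP/eq_bigr => x _.
by rewrite mulrDr psiD [c * (w / c)]mulrC divfK // mulrC.
Qed.

(** A Gaussian period when [S] is a group of powers; for any [S], the eigenvalue of the Cayley
    matrix at the character indexed by [b]. *)
Definition period (S : {set F}) b := \sum_(y in S) psi (b * y).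

Lemma period0 S : period S 0 = #|S|%:R.
Proof.
rewrite /period (eq_bigr (fun=> 1)) => [|x _]; last by rewrite mul0r psi0.
by rewrite sumr_const.
Qed.

Lemma period_Aint S b : period S b \in Aint.
Proof. by apply: rpred_sum => y _; apply: trchar_Aint _ _ _ psiP _. Qed.

Lemma period_setD (S T : {set F}) b : T \subset S ->
  period (S :\: T) b = period S b - period T b.
Proof.
move=> TS; rewrite /period [in RHS](big_setID T) /= (setIidPr TS) [X in X - _]addrC addrK.
by [].
Qed.

Lemma period_nonzero b :
  period [set x | x != 0] b = (#|F| * (b == 0))%:R - 1.
Proof.
rewrite -sum_trchar (bigD1 0) //= mulr0 psi0 addrC addrK.
by apply: eq_bigl => x; rewrite inE.
Qed.

(* The characters are common eigenvectors of all the Cayley matrices. *)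
Lemma char_poly_cayley (S : {set F}) :
  char_poly (cayley_adj S) = \prod_b ('X - (period S b)%:P).
Proof.
(* [V] is the character table, whose columns are the eigenvectors; [W] is its inverse up to the
   factor [#|F|]. *)
pose V : 'M[algC]_#|F| := \matrix_(i, j) psi (enum_val j * enum_val i).
pose W : 'M[algC]_#|F| := \matrix_(i, j) psi (- (enum_val i * enum_val j)).
pose D : 'M[algC]_#|F| := diag_mx (\row_j period S (enum_val j)).
have reindexF (h : F -> algC) : \sum_(j < #|F|) h (enum_val j) = \sum_x h x.
  rewrite [RHS](reindex_onto (enum_val : 'I_#|F| -> F) enum_rank) /=.
    by apply: eq_bigl => i; rewrite enum_valK eqxx.
  by move=> i _; rewrite enum_rankK.
have VW : V *m W = (#|F|%:R)%:M.
  apply/matrixP => i j; rewrite !mxE.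
  rewrite (eq_bigr (fun k => psi ((enum_val i - enum_val j) * enum_val k))).
    rewrite (reindexF (fun x => psi (_ * x))) sum_trchar subr_eq0.
    rewrite (inj_eq enum_val_inj).
    by case: eqP; rewrite ?muln1 ?muln0.
  by move=> k _; rewrite !mxE -psiD mulrBl ![enum_val k * _]mulrC.
have AV : cayley_adj S *m V = V *m D.
  apply/matrixP => i j; rewrite mul_mx_diag !mxE /period.
  rewrite (eq_bigr (fun k => (if enum_val k - enum_val i \in S then 1 else 0)
     * psi (enum_val j * enum_val k))) => [|k _]; last by rewrite !mxE.
  rewrite (reindexF (fun x => (if x - enum_val i \in S then 1 else 0)
     * psi (enum_val j * x))) (reindex_inj (addIr (enum_val i))) /=.
  rewrite [RHS]mulr_sumr [RHS]big_mkcond /=; apply: eq_bigr => x _.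
  by rewrite addrK mulrDr psiD; case: ifP => _; rewrite ?mul0r ?mul1r 1?mulrC.
have detV : \det V != 0.
  have: \det V * \det W != 0.
    by rewrite -det_mulmx VW det_scalar expf_neq0 // pnatr_eq0 -lt0n; apply/card_gt0P; exists 0.
  by rewrite mulf_eq0 negb_or => /andP[].
pose P := map_mx (@polyC algC) V.
(* The matrix of eigenvectors is moved to polynomial coefficients, where its nonzero determinant can
   be cancelled without inverting it. *)
have detP : \det P != 0 by rewrite det_map_mx polyC_eq0.
have -> : char_poly (cayley_adj S) = char_poly D.
  apply: (mulIf detP); rewrite /char_poly -det_mulmx mulrC -det_mulmx; congr (\det _).
  rewrite /char_poly_mx mulmxBl mulmxBr -!map_mxM /= AV.
  by rewrite scalar_mxC.
rewrite char_poly_trig ?diag_mx_is_trig //.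
rewrite (eq_bigr (fun i => 'X - (period S (enum_val i))%:P)) => [|i _]; last first.
  by rewrite !mxE eqxx mulr1n.
rewrite [RHS](reindex_onto (enum_val : 'I_#|F| -> F) enum_rank) /=.
  by apply: eq_bigl => i; rewrite enum_valK eqxx.
by move=> i _; rewrite enum_rankK.
Qed.

End Characters.

(** * Periods of the (Q + 1)-st powers *)

(** For a generator [g] and [#|F|.-1 = 2ae], the [a]-th power of [g ^+ e] has square 1 but is not
    1. *)
Lemma expr_eqN1 (F : finFieldType) a : (a * 2 %| #|F|.-1)%N ->
  exists2 x : F, x != 0 & x ^+ a = -1.
Proof.
move=> /dvdnP[e eq]; have [g gP] := finField_prim_root F.
have q0 := card_predn_gt0 F.
exists (g ^+ e); first by rewrite expf_neq0 ?(prim_root_eq0 gP) -?lt0n ?card_predn_gt0.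
have /eqP: (g ^+ e ^+ a) ^+ 2 = 1.
  by rewrite -!exprM -eq (prim_expr_order gP).
rewrite sqrf_eq1 => /orP[|/eqP//].
rewrite -exprM -(prim_order_dvd gP) eq => /dvdn_leq; nia.
Qed.

Section Hermitian.
Variables (F : finFieldType) (p : nat) (psi : F -> algC) (t s : nat).
Hypotheses (hp : prime p) (psiP : trace_character F p psi).
Local Notation Q := (p ^ t)%N.
Local Notation K := (p ^ t + 1)%N.
Hypotheses (t_gt0 : (0 < t)%N) (hq : #|F| = (Q ^ (2 * s))%N).

Let chp : p \in [pchar F].
Proof. by apply: (card_finPcharP _ hp); rewrite hq -expnM. Qed.

Let Q_gt1 : (1 < Q)%N.
Proof. by rewrite -{1}(expn0 p) ltn_exp2l ?prime_gt1. Qed.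

Let s_gt0 : (0 < s)%N.
Proof. by have := finNzRing_gt1 F; rewrite hq; case: s. Qed.

(** [(Q + 1)(Q - 1) = Q ^ 2 - 1] divides [(Q ^ 2) ^ s - 1]. *)
Lemma hermitian_dvd : (K * Q.-1 %| #|F|.-1)%N.
Proof.
rewrite hq expnM; apply: dvdn_trans (dvdn_pred_predX _ _).
by rewrite -!subn1 -{4}(exp1n 2) subn_sqr mulnC.
Qed.

(** In characteristic 2, [-1 = 1] and [x = 1] works. Otherwise [b] is even, so [2a] divides
    [#|F|.-1]. Both factorizations are needed: [a = K] and [a = Q - 1]. *)
Lemma hermitian_expr_eqN1 a b : (a * b = K * Q.-1)%N -> (odd p -> ~~ odd b) ->
  exists2 x : F, x != 0 & x ^+ a = -1.
Proof.
move=> ab hb; have [p2|po] := even_prime hp.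
  exists 1; rewrite ?oner_neq0 // expr1n.
  have /eqP := pcharf0 chp; rewrite p2 mulr2n addr_eq0 => /eqP {1}->.
  by [].
apply: expr_eqN1; apply: dvdn_trans hermitian_dvd; rewrite -ab.
by rewrite dvdn_pmul2l ?dvdn2 ?hb //; nia.
Qed.

(** With [w = g ^+ i], the equation [w ^+ (Q - 1) = 1] makes [K (Q - 1)] divide [i (Q - 1)], hence
    [K] divide [i]. *)
Lemma mem_kth_powers_fix w : w != 0 -> w ^+ Q = w -> w \in kth_powers F K.
Proof.
move=> w0 wQ; have [g gP] := finField_prim_root F.
have [i wE] := prim_root_expr F g w gP w0.
have /eqP: w ^+ Q.-1 = 1.
  by apply: (mulfI w0); rewrite mulr1 -exprS prednK // ltnW.
rewrite wE -exprM -(prim_order_dvd gP) => /(dvdn_trans hermitian_dvd).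
rewrite dvdn_pmul2r -?subn1 ?subn_gt0 // => /dvdnP[j ->].
by apply/kth_powersP; exists (g ^+ j); rewrite -?exprM // expf_neq0 ?(prim_root_eq0 gP) -?lt0n ?card_predn_gt0.
Qed.

Definition hermitian_sum b := \sum_x psi (b * x ^+ K).

Let G := hermitian_sum.

Lemma hermitian_sumM b c : c \in kth_powers F K -> G (b * c) = G b.
Proof.
case/kth_powersP => x x0 ->.
rewrite /G /hermitian_sum [RHS](reindex_inj (mulfI x0)).
by apply: eq_bigr => y _; rewrite exprMn mulrA.
Qed.

Lemma hermitian_sumE b : G b = 1 + K%:R * period F psi (kth_powers F K) b.
Proof.
rewrite /G /hermitian_sum (bigD1 0) //= expr0n addn1 /= mulr0 (trchar0 _ _ _ psiP).
rewrite -addn1 (sum_expr_kth_powers _ _ _ (fun y => psi (b * y))) ?mulr_natl //.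
exact: dvdn_trans (dvdn_mulr _ (dvdnn _)) hermitian_dvd.
Qed.

(* Since [-1] is a [K]-th power, [G b ^+ 2] is a sum over [(x, y)] of
   [psi (b (x ^+ K - y ^+ K))]; after [x := x + y] the inner sum over [y] is that
   of an additive character, trivial only on the radical of the Hermitian form. *)
Lemma hermitian_sum_sqr b :
  (forall x, b ^+ Q * x ^+ Q ^+ Q + b * x = 0 -> x = 0) -> G b ^+ 2 = #|F|%:R.
Proof.
move=> rad0.
have [c c0 cK] : exists2 x : F, x != 0 & x ^+ K = -1.
  apply: (hermitian_expr_eqN1 K Q.-1) => //.
  by move=> po; rewrite -subn1 oddB ?oddX ?po ?orbT // ltnW.
have psiD := trcharD _ _ _ psiP.
have GN : G b = \sum_y psi (- (b * y ^+ K)).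
  rewrite /G /hermitian_sum (reindex_inj (mulfI c0)).
  by apply: eq_bigr => y _; rewrite exprMn cK mulN1r mulrN.
(* The power [Q ^ (2s - 1)] undoes the power [Q], since [Q ^ (2s)] is the order of the field. *)
have injQ : injective (fun x : F => x ^+ Q).
  move=> x y /= /(congr1 (fun z => z ^+ (Q ^ (2 * s).-1))).
  have E (z : F) : z ^+ Q ^+ (Q ^ (2 * s).-1) = z; last by rewrite !E.
  rewrite -exprM -expnS prednK ?muln_gt0 ?s_gt0 //.
  by rewrite -hq expf_card.
transitivity (\sum_x psi (b * x ^+ K)
    * \sum_y psi ((b ^+ Q * x ^+ Q ^+ Q + b * x) * y ^+ Q)).
  rewrite expr2 [in X in X * _]GN /G /hermitian_sum mulr_suml.
  under [RHS]eq_bigr => x _ do rewrite mulr_sumr.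
  rewrite [RHS]exchange_big; apply: eq_bigr => y _ /=.
  rewrite mulr_sumr (reindex_inj (addIr y)); apply: eq_bigr => x _ /=.
  rewrite !mulrDl psiD; set u := b ^+ Q * _ * _.
  (* Of the two cross terms in [b (x + y) ^+ K], the one linear in [y] is replaced by its [Q]-th
     power, so that both become multiples of [y ^+ Q]. *)
  have -> : psi u = psi (b * x ^+ Q * y).
    by rewrite -[RHS](trcharXn _ _ _ psiP t) !exprMn.
  rewrite -!psiD; congr psi.
  by rewrite addn1 !exprSr (exprD_pchar_pow _ _ _ _ _ chp); ring.
rewrite (bigD1 0) //= [X in _ + X]big1 ?addr0 => [|x x0].
  have [K0 Q0] : (0 : F) ^+ K = 0 /\ (0 : F) ^+ Q = 0.
    by rewrite !expr0n addn1 ![(_ == 0)%N]eqn0Ngt (ltnW Q_gt1).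
  rewrite K0 !Q0 !mulr0 addr0 (trchar0 _ _ _ psiP) mul1r.
  rewrite (eq_bigr (fun=> 1)) ?sumr_const // => y _.
  by rewrite mul0r (trchar0 _ _ _ psiP).
set d := b ^+ Q * _ + _; have -> : \sum_y psi (d * y ^+ Q) = \sum_y psi (d * y).
  by rewrite [RHS](reindex_inj injQ).
rewrite (sum_trchar _ _ _ psiP) {}/d.
case: eqP => [/rad0 x1|]; last by rewrite muln0 mulr0.
by rewrite x1 eqxx in x0.
Qed.

(** For a nonzero solution [x], the element [(b / z) x ^+ K] is fixed by the power [Q]: the signs
    from [z] and from the equation cancel. It is thus a [K]-th power, and so is [b / z]. *)
Lemma hermitian_radical z b x : z != 0 -> z ^+ Q = - z -> b != 0 ->
  b / z \notin kth_powers F K -> b ^+ Q * x ^+ Q ^+ Q + b * x = 0 -> x = 0.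
Proof.
move=> z0 zQ b0 bz /eqP; rewrite addr_eq0 => /eqP bx.
apply/eqP; apply: contraNT bz => x0.
have xK : x ^+ K \in kth_powers F K by apply/kth_powersP; exists x.
rewrite -(kth_powersMr _ _ _ _ xK) mulrAC.
apply: mem_kth_powers_fix; first by rewrite !mulf_neq0 ?invr_eq0 ?expf_neq0.
rewrite expr_div_n zQ invrN mulrN -mulNr; congr (_ / _).
rewrite exprMn exprAC addn1 exprS mulrC -mulrA [_ * b ^+ _]mulrC.
by rewrite bx exprSr; ring.
Qed.

(* [(G b - 1) / K] is an algebraic integer and [Q ^ s] is congruent to
   [(-1) ^ s] modulo [K > 2], which leaves one of the two square roots. *)
Lemma hermitian_sign b : G b ^+ 2 = #|F|%:R -> G b = (-1) ^+ s * (Q ^ s)%:R.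
Proof.
have K0 : K%:R != 0 :> algC by rewrite pnatr_eq0 addn1.
move=> Gb2; have /eqP : G b ^+ 2 = (Q ^ s)%:R ^+ 2.
  by rewrite Gb2 hq [(2 * s)%N]mulnC expnM natrX.
rewrite eqf_sqr.
have : (G b - 1) / K%:R \in Aint.
  rewrite hermitian_sumE addrAC subrr add0r mulrC mulKf //.
  exact: period_Aint psiP _ _.
have signK : (K%:Z %| (Q ^ s)%:Z - (-1) ^+ s)%Z.
  have /dvdz_trans -> // : (K%:Z %| Q%:Z - -1)%Z by rewrite opprK PoszD.
  by rewrite -natz natrX natz subrXX dvdz_mulr.
(* A rational algebraic integer is an integer. *)
have int_of_Aint (a : int) : ((a - 1)%:~R : algC) / K%:R \in Aint -> (K%:Z %| a - 1)%Z.
  move=> aA; have : ((a - 1)%:~R : algC) / K%:R \in Num.int.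
    by apply: Cint_rat_Aint aA; rewrite rpred_div ?rpred_int ?rpred_nat.
  case/intrP => c /(congr1 (fun x => x * K%:R)); rewrite divfK // => /eqP.
  rewrite -[K%:R]/(K%:Z%:~R) -intrM eqr_int => /eqP ->; exact: dvdz_mull.
have K3 : (K > 2)%N by rewrite addn1.
have not2 : (K%:Z %| 2)%Z = false.
  by apply/negP; rewrite /dvdz /= => /(dvdn_leq (isT : (0 < 2)%N)); rewrite leqNgt K3.
have sgn (R : pzRingType) : (-1) ^+ s = (if odd s then -1 else 1) :> R.
  by rewrite -signr_odd; case: (odd s).
rewrite !sgn in signK *.
(* For either square root, the wrong parity of [s] would make [K] divide 2. *)
move=> GA /orP[] /eqP GE; rewrite GE in GA *.
  have := int_of_Aint (Q ^ s)%:Z; rewrite intrB => /(_ GA) d1.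
  case: (odd s) signK => d2; last by rewrite mul1r.
  suff: (K%:Z %| 2)%Z by rewrite not2.
  by have := rpredB d2 d1; rewrite opprB addrC addrA subrK opprK.
have := int_of_Aint (- (Q ^ s)%:Z); rewrite intrB rmorphN => /(_ GA) d1.
case: (odd s) signK => d2; first by rewrite mulN1r.
suff: (K%:Z %| 2)%Z by rewrite not2.
by have := rpredD d1 d2; rewrite addrACA addNr add0r -opprD rpredN.
Qed.

(** After exchanging the sums, orthogonality leaves only the term [x = 0]. *)
Lemma sum_hermitian_sum : \sum_b G b = #|F|%:R.
Proof.
rewrite /G /hermitian_sum exchange_big (bigD1 0) //= [X in _ + X]big1 ?addr0 => [|x x0].
  rewrite expr0n addn1 /= (eq_bigr (fun=> 1)) ?sumr_const // => b _.
  by rewrite mulr0 (trchar0 _ _ _ psiP).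
under eq_bigr => b _ do rewrite mulrC.
by rewrite (sum_trchar _ _ _ psiP) expf_eq0 (negbTE x0) andbF muln0.
Qed.

Lemma period_hermitian : exists2 z : F, z != 0 & forall b, b != 0 ->
  period F psi (kth_powers F K) b =
    (-1) ^+ (s + 1) * (Q ^ s)%:R * (b / z \in kth_powers F K)%:R
      - ((-1) ^+ (s + 1) * (Q ^ s)%:R + 1) / K%:R.
Proof.
have K0 : K%:R != 0 :> algC by rewrite pnatr_eq0 addn1.
set u : algC := (-1) ^+ (s + 1) * (Q ^ s)%:R.
have [z z0 zN] : exists2 x : F, x != 0 & x ^+ Q.-1 = -1.
  apply: (hermitian_expr_eqN1 Q.-1 K); first exact: mulnC.
  by move=> po; rewrite oddD oddX po orbT.
have zQ : z ^+ Q = - z.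
  by rewrite -(prednK (ltnW Q_gt1)) exprSr zN mulN1r.
exists z => //.
(* Off the coset of [z] the form is nondegenerate; [- u] is the value [(-1) ^+ s * Q ^ s]. *)
have Gout b : b != 0 -> b / z \notin kth_powers F K -> G b = - u.
  move=> b0 bz; rewrite /u addn1 exprS mulN1r mulNr opprK.
  apply/hermitian_sign/hermitian_sum_sqr => x.
  exact: hermitian_radical bz.
have Gin b : b / z \in kth_powers F K -> G b = G z.
  by move/(hermitian_sumM z) <-; rewrite mulrC divfK.
have GE b : b != 0 -> G b = (G z + u) * (b / z \in kth_powers F K)%:R - u.
  move=> b0; case: (boolP (_ \in _)) => [/Gin ->|/(Gout _ b0) ->].
    by rewrite mulr1 addrK.
  by rewrite mulr0 add0r.
have kdvd : (K %| #|F|.-1)%N.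
  exact: dvdn_trans (dvdn_mulr _ (dvdnn _)) hermitian_dvd.
(* The term [b = 0] already contributes [#|F|], so the sum of [G] over nonzero [b] vanishes; as
   [#|F|.-1] is [K] times the coset size, this determines [G z]. *)
have Gz : G z = (K%:R - 1) * u.
  have := sum_hermitian_sum; rewrite (bigD1 0) //= {1}/G /hermitian_sum.
  rewrite (eq_bigr (fun=> 1)) => [|x _]; last by rewrite mul0r (trchar0 _ _ _ psiP).
  rewrite sumr_const -[X in _ = X]addr0 => /addrI.
  rewrite (eq_bigr _ (fun b => GE b)) sumrB -mulr_sumr.
  rewrite (reindex_inj (mulIf z0)) /= -natr_sum.
  rewrite (eq_bigl (fun y => y != 0)) => [|y]; last first.
    by rewrite mulf_eq0 negb_or z0 andbT.
  under eq_bigr => y _ do rewrite mulfK //.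
  rewrite -big_mkcondr /= sum1_card.
  have -> : #|(fun y => (y != 0) && (y \in kth_powers F K))| = #|kth_powers F K|.
    apply: eq_card => y; rewrite unfold_in /=.
    by apply/andP/idP => [[]|yk] //; rewrite (kth_powers_neq0 _ _ _ yk).
  rewrite sumr_const cardC1 -(card_kth_powers _ _ kdvd) -[u *+ _]mulr_natr natrM.
  have n0 : #|kth_powers F K|%:R != 0 :> algC.
    rewrite pnatr_eq0 -lt0n; apply/card_gt0P; exists 1.
    by apply/kth_powersP; exists 1; rewrite ?oner_neq0 ?expr1n.
  move=> /eqP; rewrite subr_eq0 => /eqP e; apply: (mulIf n0).
  apply: (addIr (u * #|kth_powers F K|%:R)).
  by rewrite -mulrDl e; ring.
move=> b b0; have := hermitian_sumE b; rewrite GE // Gz => e.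
apply: (mulfI K0); rewrite -[LHS](addKr 1) -e.
by move: K0; move: (K%:R) => c c0; field.
Qed.

End Hermitian.

(** * Periods of the k-th powers *)

(** For each [y] in the smaller group, multiplication by [y] permutes the larger one, so every [y]
    contributes the same period. *)
Lemma sum_period_cosets (F : finFieldType) p (psi : F -> algC) k l b :
  trace_character F p psi -> (k %| l)%N ->
  \sum_(c in kth_powers F k) period F psi (kth_powers F l) (b * c) =
    #|kth_powers F l|%:R * period F psi (kth_powers F k) b.
Proof.
move=> psiP kl; rewrite /period exchange_big /= mulr_natl -sumr_const.
apply: eq_bigr => y yl; have yk := subsetP (kth_powersS F k l kl) y yl.
rewrite [RHS](reindex_inj (mulIf (kth_powers_neq0 _ _ _ yk))) /=.
by apply: eq_big => c; rewrite ?kth_powersMr // mulrA.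
Qed.

(** The coset [b R_k] either equals [R_k], which contains [R_l], or is disjoint from it. *)
Lemma card_coset_kth_powers (F : finFieldType) k l (b : F) : (k %| l)%N -> b != 0 ->
  (\sum_(c in kth_powers F k) ((b * c)%R \in kth_powers F l) =
    #|kth_powers F l| * (b \in kth_powers F k))%N.
Proof.
move=> kl b0; have lk := subsetP (kth_powersS F k l kl).
have [bk|bk] := boolP (b \in _); last first.
  rewrite muln0 big1 // => c ck; apply/eqP; rewrite eqb0.
  by apply: contra bk => /lk; rewrite kth_powersMr.
have bVk := kth_powersV _ _ _ bk.
rewrite muln1 (reindex_inj (mulfI (invr_neq0 b0))) /= -sum1_card [RHS]big_mkcond.
rewrite [LHS]big_mkcond /=; apply: eq_bigr => y _.
rewrite mulrC kth_powersMr // mulrC mulVKf //.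
by case: (boolP (y \in kth_powers F l)) => [/lk ->|_] //; rewrite if_same.
Qed.

(** Averaging over [R_k] preserves the shape of the formula with the same [u] and [z]; the ratio
    [l / k] of the group sizes turns the denominator [l] into [k]. *)
Lemma period_divisor (F : finFieldType) p (psi : F -> algC) k l u z :
  trace_character F p psi -> (k %| l)%N -> (l %| #|F|.-1)%N -> z != 0 ->
  (forall b, b != 0 -> period F psi (kth_powers F l) b =
     u * (b / z \in kth_powers F l)%:R - (u + 1) / l%:R) ->
  forall b, b != 0 -> period F psi (kth_powers F k) b =
     u * (b / z \in kth_powers F k)%:R - (u + 1) / k%:R.
Proof.
move=> psiP kl lq z0 periodl b b0.
have kq := dvdn_trans kl lq; have q0 := card_predn_gt0 F.
have [k0 l0] : k%:R != 0 :> algC /\ l%:R != 0 :> algC.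
  by rewrite !pnatr_eq0 -!lt0n (dvdn_gt0 q0 kq) (dvdn_gt0 q0 lq).
have cardE : #|kth_powers F k|%:R * k%:R = #|kth_powers F l|%:R * l%:R :> algC.
  by rewrite -!natrM !card_kth_powers.
have nl0 : #|kth_powers F l|%:R != 0 :> algC.
  rewrite pnatr_eq0; apply: contraL q0 => /eqP nl0.
  by rewrite -(card_kth_powers F l lq) nl0.
apply: (mulfI nl0); rewrite -(sum_period_cosets _ _ _ _ _ _ psiP kl).
rewrite (eq_bigr (fun c => u * (b / z * c \in kth_powers F l)%:R
    - (u + 1) / l%:R)) => [|c ck]; last first.
  by rewrite periodl 1?mulrAC // mulf_neq0 ?(kth_powers_neq0 _ _ _ ck).
rewrite sumrB -mulr_sumr -natr_sum card_coset_kth_powers //; last first.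
  by rewrite mulf_neq0 ?invr_eq0.
rewrite sumr_const -[_ *+ #|_|]mulr_natr natrM.
have -> : #|kth_powers F k|%:R = #|kth_powers F l|%:R * l%:R / k%:R :> algC.
  by rewrite -cardE mulfK.
move: (_ \in _)%:R (#|_|%:R) k%:R l%:R k0 l0 => e N k' l' k0 l0.
by field; rewrite k0.
Qed.

(** Converts a function constant on one coset and on the rest of the nonzero elements into
    multiplicities. *)
Lemma prod_two_values (F : finFieldType) (R : comPzRingType) k z (f : F -> R) A B :
  (k %| #|F|.-1)%N -> z != 0 ->
  (forall b, b != 0 -> f b = if b / z \in kth_powers F k then A else B) ->
  \prod_b f b = f 0 * A ^+ #|kth_powers F k| * B ^+ ((k - 1) * #|kth_powers F k|).
Proof.
move=> kq z0 fE; rewrite (bigD1 0) //= -mulrA; congr (_ * _).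
rewrite (eq_bigr _ fE) (reindex_inj (mulIf z0)) /=.
rewrite (eq_bigr (fun y => if y \in kth_powers F k then A else B)) => [|y _]; last first.
  by rewrite mulfK.
rewrite (eq_bigl (mem (predC1 (0 : F)))) => [|y]; last first.
  by rewrite mulf_eq0 negb_or z0 andbT.
rewrite (bigID (mem (kth_powers F k))) /=.
rewrite (eq_bigr (fun=> A)) => [|y /andP[_ ->]] //.
rewrite [X in _ * X](eq_bigr (fun=> B)) => [|y /andP[_ /negbTE->]] //.
have cardI : #|[predI predC1 (0 : F) & kth_powers F k]| = #|kth_powers F k|.
  apply: eq_card => y; rewrite !inE andb_idl //.
  exact: kth_powers_neq0.
rewrite !prodr_const; congr (_ ^+ _ * _ ^+ _); first exact: cardI.
have := cardID (mem (kth_powers F k)) (predC1 (0 : F)).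
rewrite cardC1 -(card_kth_powers F k kq) mulnBl mul1n => h.
rewrite [X in (X - _)%N]mulnC -h -[X in (_ - X)%N]cardI addnC addnK.
by apply: eq_card => y; rewrite !inE andbC.
Qed.

(** * Divisibility of exponents by the least [t] *)

(** Since [p ^ t] is [-1] modulo [k], subtracting [t] from [u] swaps the residues [1] and [-1]; the
    induction therefore carries both. *)
Lemma dvdn_least_expD1 (p k t : nat) : (2 < k)%N -> (0 < t)%N -> (0 < p)%N ->
  (k %| p ^ t + 1)%N ->
  (forall j, (0 < j)%N -> (k %| p ^ j + 1)%N -> (t <= j)%N) ->
  forall u, (k %| p ^ u + 1)%N \/ (k %| p ^ u - 1)%N -> (t %| u)%N.
Proof.
move=> k2 t0 p0 kt tmin u; elim/ltn_ind: u => u IH ku.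
(* For [0 < u < t], residue [-1] contradicts minimality at [u], and residue [1] contradicts it at
   [t - u]. *)
have [ut|tu] := ltnP u t.
  case: (posnP u) => [->|u0]; first exact: dvdn0.
  case: ku => [/(tmin _ u0)|ku]; first by rewrite leqNgt ut.
  have: (k %| p ^ (t - u) + 1)%N.
    have E : (p ^ t + 1 = p ^ (t - u) * (p ^ u - 1) + (p ^ (t - u) + 1))%N.
      rewrite mulnBr muln1 -expnD subnK 1?ltnW // addnA subnK //.
      by rewrite leq_pexp2l // leq_subr.
    by move: kt; rewrite E dvdn_addr // dvdn_mull.
  move/tmin; rewrite subn_gt0 ut => /(_ isT); lia.
have pu : (p ^ u = p ^ t * p ^ (u - t))%N by rewrite -expnD subnKC.
have Q0 : (0 < p ^ (u - t))%N by rewrite expn_gt0 p0.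
rewrite -(subnK tu) dvdn_add //; apply: IH; first lia.
case: ku => ku; [right|left].
  have : (k %| p ^ (u - t) * (p ^ t + 1) - (p ^ u + 1))%N.
    by apply: dvdn_sub => //; apply: dvdn_mull.
  by congr (_ %| _)%N; rewrite pu; nia.
have : (k %| p ^ (u - t) * (p ^ t + 1) - (p ^ u - 1))%N.
  by apply: dvdn_sub => //; apply: dvdn_mull.
congr (_ %| _)%N; rewrite pu.
have : (0 < p ^ t)%N by rewrite expn_gt0 p0.
by nia.
Qed.

(** Makes the quotient defining [s] exact. For [k = 2] the prime is odd, so [t = 1]; otherwise the
    exponent given by semiprimitivity is a multiple of [t]. *)
Lemma semiprimitive_dvdn_half (p m k t : nat) : prime p -> ~~ odd m -> (0 < m)%N ->
  semiprimitive p m k -> (0 < t)%N -> (k %| p ^ t + 1)%N ->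
  (forall j : nat, (0 < j)%N -> (k %| p ^ j + 1)%N -> (t <= j)%N) ->
  (t %| m./2)%N.
Proof.
move=> hp hm m0 [_ [[-> q1]|[k2 [[t' [t'0 [t'm kt']]] _]]]] t0 kt tmin.
  suff: (t <= 1)%N by case: t t0 {kt tmin} => [|[]].
  apply: tmin => //; rewrite expn1 dvdn2 oddD addbT negbK.
  have : odd (p ^ m) by rewrite (divn_eq (p ^ m) 4) q1 oddD oddM andbF.
  by rewrite oddX eqn0Ngt m0.
by apply: dvdn_trans t'm; apply: (dvdn_least_expD1 p k t) => //; [exact: prime_gt0|left].
Qed.

(** * The two spectra and the distinctness of the eigenvalues *)

Theorem theorem3p3 (F : finFieldType) (p m k : nat)
  (hp : prime p) (hq : #|F| = (p ^ m)%N) (hm : ~~ odd m)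
  (hsp : semiprimitive p m k)
  (t : nat) (ht0 : (0 < t)%N) (htk : (k %| p ^ t + 1)%N)
  (htmin : forall j : nat, (0 < j)%N -> (k %| p ^ j + 1)%N -> (t <= j)%N) :
  let n : nat := ((p ^ m - 1) %/ k)%N in
  let s : nat := (m %/ (2 * t))%N in
  let sigma : algC := (-1) ^+ (s + 1) in
  let r : algC := (p ^ (m %/ 2))%:R in
  let lam1 : algC := (sigma * (k - 1)%:R * r - 1) / k%:R in
  let lam2 : algC := - ((sigma * r + 1) / k%:R) in
  [/\ char_poly (paley_adj F k) =
        ('X - (n%:R)%:P) * ('X - lam1%:P) ^+ n * ('X - lam2%:P) ^+ ((k - 1) * n),
      char_poly (paley_bar_adj F k) =
        ('X - (((k - 1) * n)%N%:R)%:P) * ('X - ((k - 1)%:R * lam2)%:P) ^+ n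
          * ('X - (-1 - lam2)%:P) ^+ ((k - 1) * n),
      (n%:R != lam1), (n%:R != lam2) & (lam1 != lam2)].
Proof.
move=> n s sigma r lam1 lam2.
have m0 : (0 < m)%N by have := finNzRing_gt1 F; rewrite hq; case: (m).
have k1 : (1 < k)%N by case: hsp => _ [[->]|[/ltnW]].
have q1 : (1 < p ^ m)%N by rewrite -hq finNzRing_gt1.
have kn0 : k%:R != 0 :> algC by rewrite pnatr_eq0 -lt0n ltnW.
have mE : m = (2 * t * s)%N.
  have /dvdnP[a ma] := semiprimitive_dvdn_half p m k t hp hm m0 hsp ht0 htk htmin.
  have mE : m = (2 * t * a)%N.
    by rewrite -(odd_double_half m) (negbTE hm) ma -mul2n mulnA mulnAC.
  by rewrite {1}mE /s mE mulKn // muln_gt0.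
have qE : #|F| = ((p ^ t) ^ (2 * s))%N by rewrite hq {1}mE -expnM mulnCA mulnA.
have rE : r = ((p ^ t) ^ s)%:R by rewrite /r {1}mE -mulnA mulKn // expnM.
have predE : #|F|.-1 = (p ^ m - 1)%N by rewrite hq subn1.
have kq : (k %| #|F|.-1)%N by rewrite predE; case: hsp.
have nE : #|kth_powers F k| = n.
  by rewrite /n -predE -(card_kth_powers F k kq) mulnK // ltnW.
have qr : #|F|%:R = r ^+ 2 by rewrite qE [(2 * s)%N]mulnC expnM natrX rE.
have nk : n%:R * k%:R = r ^+ 2 - 1 :> algC.
  rewrite -natrM -nE card_kth_powers // predE natrB 1?ltnW //.
  by rewrite -hq qr.
have kE : (k - 1)%:R = k%:R - 1 :> algC by rewrite natrB // ltnW.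
have sigma2 : sigma ^+ 2 = 1 by rewrite -exprM mulnC exprM sqrrN !expr1n.
pose u := sigma * r.
(* In this form [lam1 = u + lam2], which matches the period formula on and off the coset. *)
have lam1E : lam1 = u - (u + 1) / k%:R.
  by rewrite /lam1 kE /u; move: kn0; move: (k%:R) => c c0; field.
have [psi psiP] := trace_character_exists F p m hp hq.
have [z z0 periodE] :
    exists2 z : F, z != 0 & forall b, b != 0 -> period F psi (kth_powers F k) b =
      if b / z \in kth_powers F k then lam1 else lam2.
  have [z z0 zP] := period_hermitian F p psi t s hp psiP ht0 qE.
  exists z => // b b0; rewrite -rE in zP.
  rewrite (period_divisor _ _ _ _ _ _ _ psiP htk _ z0 zP) //; last first.
    exact: dvdn_trans (dvdn_mulr _ (dvdnn _)) (hermitian_dvd F p t s qE).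
  by rewrite lam1E; case: ifP => _; rewrite ?mulr1 // mulr0 sub0r.
have r0 : r != 0 by rewrite pnatr_eq0 -lt0n expn_gt0 prime_gt0.
have r1 : (1 < p ^ (m %/ 2))%N.
  by rewrite -{1}(expn0 p) ltn_exp2l ?prime_gt1 // divn_gt0 //; move: m0 hm; case: (m) => [|[]].
have sigma0 : sigma != 0 by rewrite signr_eq0.
split.
- rewrite /paley_adj (char_poly_cayley F p psi psiP).
  rewrite (prod_two_values F _ k z _ ('X - lam1%:P) ('X - lam2%:P)) //.
    by rewrite (period0 _ _ _ psiP) nE.
  by move=> b b0; rewrite periodE //; case: ifP.
- rewrite /paley_bar_adj (char_poly_cayley F p psi psiP).
  have sub : kth_powers F k \subset [set x : F | x != 0].
    by apply/subsetP => x /kth_powers_neq0; rewrite inE.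
  rewrite (prod_two_values F _ k z _ ('X - ((k - 1)%:R * lam2)%:P)
    ('X - (-1 - lam2)%:P)) //.
    rewrite period_setD // (period_nonzero _ _ _ psiP) (period0 _ _ _ psiP) nE eqxx muln1.
    congr (('X - _%:P) * _ * _); rewrite natrM kE mulrBl mul1r mulrC nk.
    by rewrite qr.
  (* Complementary periods add up to [-1] at nonzero [b], and [-1 - lam1 = (k - 1) lam2]. *)
  move=> b b0; rewrite period_setD // (period_nonzero _ _ _ psiP) (negbTE b0).
  rewrite muln0 sub0r periodE //; case: ifP => // _; congr ('X - _%:P).
  rewrite lam1E kE /lam2 -/u; move: kn0; move: (k%:R) => c c0.
  by field.
(* Equality would give [r = sigma (k - 1)], hence [k = r + 1]: excluded by hypothesis for [k > 2],
   and by [r > 1] for [k = 2]. *)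
- apply/eqP => /(congr1 (fun x => x * k%:R)).
  rewrite nk /lam1 divfK // mulrAC => /addIr; rewrite expr2 mulrAC.
  move/(mulIf r0)/(congr1 (fun x => x ^+ 2)); rewrite exprMn sigma2 mul1r.
  rewrite -!natrX => /eqP; rewrite eqr_nat eqn_exp2r // => /eqP rk.
  case: hsp => _ [[k2 _]|[_ [_ []]]]; first by rewrite rk k2 in r1.
  by rewrite -divn2 rk subnK // ltnW.
(* Equality would give [r = - sigma], hence [r ^+ 2 = 1]. *)
- apply/eqP => /(congr1 (fun x => x * k%:R)).
  rewrite nk /lam2 mulNr divfK // opprD => /addIr; rewrite expr2 -mulNr.
  move/(mulIf r0)/(congr1 (fun x => x ^+ 2)); rewrite sqrrN sigma2.
  by rewrite -natrX => /eqP; rewrite pnatr_eq1 gtn_eqF // -{1}(exp1n 2) ltn_exp2r.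
- rewrite lam1E /lam2 -/u -subr_eq0 opprK subrK.
  by rewrite mulf_neq0.
Qed.
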